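(* Let $k=k_p$, $N_T=N_{T,p}$, $m=m_p$, $N_S=N_{S,p}$ be positive integers and $\delta_p\in(0,1)$ such that, as $p\to\infty$, $$\frac kp\to\vartheta,\quad (p-k)\delta_p\to\eta,\quad \frac{N_T}p\to\rho_T,\quad \frac mp\to\rho_m,\quad \frac{N_S}p\to\rho_S,$$ where $\vartheta,\rho_T\in(0,1)$, $\eta\in(0,\infty)$, $\rho_m,\rho_S\in(0,\infty)$, and $\rho_T\ne\vartheta$, $\rho_m\neq\rho_S$, $\rho_m,\rho_S\ne\vartheta$, $\rho_m,\rho_S\neq1$. Let $\mathsf{W2SG}_p^{\mathrm{DE}}$ be the master deterministic-equivalent gain defined in the context, and let $\Lambda_T:=\vartheta-\rho_T$ if $\rho_T<\vartheta$ and $\Lambda_T:=\frac{(1-\vartheta)(\rho_T-\vartheta)}{1-\rho_T}$ if $\rho_T>\vartheta$. Fix $\rho_m>\vartheta$. Below, ''$\mathsf{W2SG}_p^{\mathrm{DE}}>0$'' means that the inequality holds for all sufficiently large $p$. (i) (Feature-bottleneck regime.) Suppose $\vartheta<\rho_S<\min\{1,\rho_m\}$. Let $D_S:=(\rho_m+2\vartheta)^2-8\rho_m(\vartheta+\Lambda_T)$. If $D_S>0$, then $$\mathsf{W2SG}_p^{\mathrm{DE}}>0\iff\rho_S\in\left(\frac{\rho_m+2\vartheta-\sqrt{D_S}}4,\ \frac{\rho_m+2\vartheta+\sqrt{D_S}}4\right)\cap(\vartheta,\min\{1,\rho_m\}).$$ If $D_S\le0$, there is no positive region on this branch, i.e.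 $\mathsf{W2SG}_p^{\mathrm{DE}}>0$ holds for no $\rho_S\in(\vartheta,\min\{1,\rho_m\})$. (Thus the feature-bottleneck positive region is a bounded interval in $\rho_S$.) (ii) (Sample-bottleneck regime.) Suppose $\vartheta<\rho_m<\min\{1,\rho_S\}$. If $\rho_m\le2\vartheta$, there is no positive region on this branch, i.e. $\mathsf{W2SG}_p^{\mathrm{DE}}>0$ holds for no such $\rho_S$. If $\rho_m>2\vartheta$, then $$\mathsf{W2SG}_p^{\mathrm{DE}}>0\iff\rho_S>\frac{\rho_m(2\rho_m-3\vartheta+\Lambda_T)}{\rho_m-2\vartheta}.$$ (Thus the sample-bottleneck positive region is a half-line in $\rho_S$.)
   Context: **Master deterministic-equivalent gain.** (It is the deterministic equivalent of teacher risk minus student risk in a two-stage linear random-feature model with input covariance $\operatorname{diag}(I_k,\delta_pI_{p-k})$, unit-norm target supported on the first $k$ coordinates, $N_T$ teacher features, $N_S$ student features and $m$ teacher-labeled samples.) For $\tau\ge0$ put $$\operatorname{df}_p(\tau)=\frac1p\left[\frac k{1+\tau}+\frac{(p-k)\delta_p}{\delta_p+\tau}\right],\quad \operatorname{df}^{(2)}_p(\tau)=\frac1p\left[\frac k{(1+\tau)^2}+\frac{(p-k)\delta_p^2}{(\delta_p+\tau)^2}\right],\quad \Delta_p(\tau)=\frac1{\delta_p+\tau}-\frac1{1+\tau}.$$ *Teacher.* For $N_T<p$ let $\tau_T>0$ be the unique solution of $\operatorname{df}_p(\tau_T)=N_T/p$ ($\tau_T=0$ if $N_T\ge p$). Put $a=\frac1{1+\tau_T}$,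 $c=a-a^2$, $\Theta=\left[1+\frac{k(\delta_p+\tau_T)^2}{(p-k)\delta_p(1+\tau_T)^2}\right]^{-1}$, $V=c\,\Theta$, $S=a-c\,\Theta$. *Student.* If $p<\min\{m,N_S\}$ set $\tau_S=0$; if $N_S<\min\{m,p\}$ let $\tau_S>0$ be the unique solution of $\operatorname{df}_p(\tau_S)=N_S/p$; if $m<\min\{p,N_S\}$ let $\tau_S>0$ be the unique solution of $\operatorname{df}_p(\tau_S)=m/p$. Put $\mathcal T^{(1)}(\tau)=\frac S{1+\tau}+\frac V{\delta_p+\tau}$, $\mathcal T^{(2)}(\tau)=\frac S{(1+\tau)^2}+\frac V{(\delta_p+\tau)^2}$ and $$\mathcal M=\begin{cases}0,&p<\min\{m,N_S\},\\[1mm] \dfrac{\tau_S\mathcal T^{(1)}(\tau_S)}{1-N_S/m},&N_S<\min\{m,p\},\\[3mm] \dfrac{\tau_S^2\mathcal T^{(2)}(\tau_S)}{1-(p/m)\operatorname{df}_p^{(2)}(\tau_S)}+\dfrac{\tau_S\mathcal T^{(1)}(\tau_S)(m/N_S)}{1-m/N_S},&m<\min\{p,N_S\}.\end{cases}$$ Then $\mathsf{W2SG}_p^{\mathrm{DE}}:=2\tau_SV\Delta_p(\tau_S)-\mathcal M$.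
   Formalization: For a single sequence N_S the claims are asserted except when ρ_S is an interval endpoint, the double root (D_S=0) or the threshold, where they can fail; at those values ''W2SG>0'' means eventual positivity for every N_S with N_S/p→ρ_S. *)

(* Defs.v *)
From mathcomp Require Import all_boot all_order all_algebra.
From mathcomp Require Import all_classical all_reals all_analysis.

Set Implicit Arguments.
Unset Strict Implicit.
Unset Printing Implicit Defensive.

Import Order.TTheory GRing.Theory Num.Theory.
Import numFieldNormedType.Exports.

Local Open Scope classical_set_scope.
Local Open Scope ring_scope.

Section Gain.
Context {R : realType}.
Implicit Types (p k n NT NS m : nat) (delta tau : R).

(* [p%:R - k%:R] is a subtraction in [R], not the truncated one of [nat]. *)
Definition df p k delta tau : R :=
  p%:R^-1 * (k%:R / (1 + tau) + (p%:R - k%:R) * delta / (delta + tau)).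

Definition df2 p k delta tau : R :=
  p%:R^-1 * (k%:R / (1 + tau) ^+ 2
             + (p%:R - k%:R) * delta ^+ 2 / (delta + tau) ^+ 2).

Definition Delta delta tau : R := (delta + tau)^-1 - (1 + tau)^-1.

(* The positive solution [tau] of [df tau = n / p]. It exists and is unique
   when [0 < n < p], [k <= p] and [0 < delta < 1]; the value is 0 if there is
   no positive solution. *)
Definition tau_sol p k delta n : R :=
  xget 0 [set tau | 0 < tau /\ df p k delta tau = n%:R / p%:R].

Definition tauT p k NT delta : R :=
  if (NT < p)%N then tau_sol p k delta NT else 0.

Definition acoef p k NT delta : R := (1 + tauT p k NT delta)^-1.

Definition ccoef p k NT delta : R :=
  acoef p k NT delta - acoef p k NT delta ^+ 2.

Definition Theta p k NT delta : R :=
  let tau := tauT p k NT delta in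
  (1 + k%:R * (delta + tau) ^+ 2
       / ((p%:R - k%:R) * delta * (1 + tau) ^+ 2))^-1.

Definition Vcoef p k NT delta : R := ccoef p k NT delta * Theta p k NT delta.

Definition Scoef p k NT delta : R :=
  acoef p k NT delta - ccoef p k NT delta * Theta p k NT delta.

(* The last branch of [tauS] and of [Mterm] is reached only when the minimum
   of [p], [NS] and [m] is attained twice; it is a dummy value, the quantity
   being undefined there. *)
Definition tauS p k NS m delta : R :=
  if (p < minn m NS)%N then 0
  else if (NS < minn m p)%N then tau_sol p k delta NS
  else if (m < minn p NS)%N then tau_sol p k delta m
  else 0.

Definition T1 p k NT delta tau : R :=
  Scoef p k NT delta / (1 + tau) + Vcoef p k NT delta / (delta + tau).

Definition T2 p k NT delta tau : R :=
  Scoef p k NT delta / (1 + tau) ^+ 2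
  + Vcoef p k NT delta / (delta + tau) ^+ 2.

Definition Mterm p k NT NS m delta : R :=
  let tau := tauS p k NS m delta in
  if (p < minn m NS)%N then 0
  else if (NS < minn m p)%N then
    tau * T1 p k NT delta tau / (1 - NS%:R / m%:R)
  else if (m < minn p NS)%N then
    tau ^+ 2 * T2 p k NT delta tau
      / (1 - p%:R / m%:R * df2 p k delta tau)
    + tau * T1 p k NT delta tau * (m%:R / NS%:R) / (1 - m%:R / NS%:R)
  else 0.

Definition W2SG p k NT NS m delta : R :=
  let tau := tauS p k NS m delta in
  2 * tau * Vcoef p k NT delta * Delta delta tau - Mterm p k NT NS m delta.

Definition ratio_cvg (u : nat -> nat) (l : R) : Prop :=
  (fun p => (u p)%:R / p%:R : R) @ \oo --> l.

Definition pos_seq (u : nat -> nat) : Prop :=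
  forall p, (0 < p)%N -> (0 < u p)%N.

Definition W2SG_eventually_pos (k NT NS m : nat -> nat) (delta : nat -> R) :
    Prop :=
  \forall p \near \oo, 0 < W2SG p (k p) (NT p) (NS p) (m p) (delta p).

(* Positivity of the gain as a property of the limiting ratio [rhoS]: it must
   hold for every student-width sequence with that limit. At a zero of the
   leading-order term of the gain, a single sequence [NS] may be eventually
   positive or not according to how [NS p / p] approaches [rhoS]. *)
Definition W2SG_pos (k NT m : nat -> nat) (delta : nat -> R) (rhoS : R) :
    Prop :=
  forall NS : nat -> nat, pos_seq NS -> ratio_cvg NS rhoS ->
    W2SG_eventually_pos k NT NS m delta.

Definition LambdaT (theta rhoT : R) : R :=
  if rhoT < theta then theta - rhoT
  else (1 - theta) * (rhoT - theta) / (1 - rhoT).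

Definition DS (theta rhoT rhom : R) : R :=
  (rhom + 2 * theta) ^+ 2 - 8 * rhom * (theta + LambdaT theta rhoT).

Definition rhoS_lo (theta rhoT rhom : R) : R :=
  (rhom + 2 * theta - Num.sqrt (DS theta rhoT rhom)) / 4.

Definition rhoS_hi (theta rhoT rhom : R) : R :=
  (rhom + 2 * theta + Num.sqrt (DS theta rhoT rhom)) / 4.

Definition rhoS_threshold (theta rhoT rhom : R) : R :=
  rhom * (2 * rhom - 3 * theta + LambdaT theta rhoT) / (rhom - 2 * theta).

End Gain.

(* Main.v *)
Require Import Defs.
From mathcomp Require Import all_boot all_order all_algebra.
From mathcomp Require Import all_classical all_reals all_analysis.
From mathcomp Require Import ring lra.

(* Everything is of order delta. If n / p tends to some rho in (theta, 1), the
   solution tau of df tau = n / p tends to 0 at the rate of delta: the ratio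
   u = delta / (delta + tau) tends to (rho - theta) / (1 - theta), and
   tau / delta = 1 / u - 1. If rho < theta, tau tends to theta / rho - 1. In
   both teacher regimes V / delta tends to some v > 0 and S to
   v Lambda_T / (1 - theta), so that W2SG / delta tends to a positive multiple
   of feature_sign or sample_sign below: as functions of rho_S, the first is
   a concave quadratic of discriminant D_S, the second is affine with slope
   rho_m - 2 theta. Where the limit vanishes, the property W2SG_pos fails
   because it is open in rho_S while the sign is negative at points arbitrarily
   close. *)

Set Implicit Arguments.
Unset Strict Implicit.
Unset Printing Implicit Defensive.

Import Order.TTheory GRing.Theory Num.Theory.
Import numFieldNormedType.Exports.

Local Open Scope classical_set_scope.
Local Open Scope ring_scope.

(** * Two facts on limits of sequences *)

Lemma invn_cvg0 {R : realType} : (fun p => p%:R^-1 : R) @ \oo --> 0.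
Proof.
by rewrite -(cvg_shiftS (fun p => p%:R^-1 : R)); exact: cvg_harmonic.
Qed.

(** Keeping [l] apart from [l'] lets a limit be assembled in the shape of [f] and only then
    simplified by algebra. *)
Lemma near_eq_cvgn {R : realType} (f g : nat -> R) (l l' : R) :
  l = l' -> (\forall p \near \oo, f p = g p) -> f @ \oo --> l -> g @ \oo --> l'.
Proof.
move=> <- fg; apply: cvg_trans; apply: near_eq_cvg.
by apply: filterS fg.
Qed.

(** * The fixed-point equation at finite [p] *)

Section TauSol.
Context {R : realType}.

(** Only [k / p] and the ratio [delta / (delta + tau)] are left; both have finite limits although
    [delta] and possibly [tau] vanish. *)
Lemma dfE p k (delta tau : R) : (0 < p)%N ->
  df p k delta tau =
  k%:R / p%:R / (1 + tau) + (1 - k%:R / p%:R) * (delta / (delta + tau)).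
Proof.
move=> p0; have p_neq0 : p%:R != 0 :> R by rewrite pnatr_eq0 -lt0n.
rewrite /df mulrDr; congr (_ + _).
  by rewrite mulrA [_^-1 * _]mulrC.
by rewrite !mulrA mulrBr mulVf// [_^-1 * k%:R]mulrC.
Qed.

Lemma df2E p k (delta tau : R) : (0 < p)%N ->
  df2 p k delta tau =
  k%:R / p%:R / (1 + tau) ^+ 2
  + (1 - k%:R / p%:R) * (delta / (delta + tau)) ^+ 2.
Proof.
move=> p0; have p_neq0 : p%:R != 0 :> R by rewrite pnatr_eq0 -lt0n.
rewrite /df2 mulrDr expr_div_n; congr (_ + _).
  by rewrite mulrA [_^-1 * _]mulrC.
by rewrite !mulrA mulrBr mulVf// [_^-1 * k%:R]mulrC.
Qed.

(* Clearing denominators, [df tau = n / p] becomes a quadratic equation in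
   [tau] whose roots have the negative product [delta (n - p) / n]. *)
Lemma tau_solP p k (delta : R) n : (0 < n < p)%N -> 0 < delta < 1 ->
  0 < tau_sol p k delta n /\ df p k delta (tau_sol p k delta n) = n%:R / p%:R.
Proof.
move=> /andP[n_gt0 n_lt_p] /andP[delta_gt0 delta_lt1].
have p_gt0 : (0 < p)%N by exact: leq_trans n_lt_p.
have n0 : 0 < n%:R :> R by rewrite ltr0n.
have np : n%:R < p%:R :> R by rewrite ltr_nat.
rewrite /tau_sol.
suff /(xgetPex 0) [] : exists tau, [set tau : R | 0 < tau /\
    df p k delta tau = n%:R / p%:R] tau by [].
pose b : R := n%:R * (1 + delta) - k%:R - (p%:R - k%:R) * delta.
pose D := b ^+ 2 + 4 * n%:R * delta * (p%:R - n%:R).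
have prod_gt0 : 0 < 4 * n%:R * delta * (p%:R - n%:R).
  by rewrite !mulr_gt0// subr_gt0.
have D_ge0 : 0 <= D by rewrite addr_ge0 ?sqr_ge0// ltW.
have b_lt : b < Num.sqrt D.
  rewrite (le_lt_trans (ler_norm b))// -sqrtr_sqr ltr_sqrt ?ltrDl//.
  by rewrite ltr_wpDl ?sqr_ge0.
have sqrtD2 : Num.sqrt D ^+ 2 = D by rewrite sqr_sqrtr.
(* The positive root of the quadratic with linear coefficient [b] and discriminant [D]. *)
pose tau := (Num.sqrt D - b) / (2 * n%:R).
have tau_gt0 : 0 < tau by rewrite divr_gt0 ?mulr_gt0// subr_gt0.
exists tau; split => //.
have quad : n%:R * tau ^+ 2 + b * tau = delta * (p%:R - n%:R).
  rewrite /tau.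
  transitivity ((Num.sqrt D ^+ 2 - b ^+ 2) / (4 * n%:R)); first by field; lra.
  by rewrite sqrtD2 /D; field; lra.
have p0 : p%:R != 0 :> R by lra.
rewrite /df; apply: (mulfI p0); rewrite mulVKf// [RHS]mulrCA divff// mulr1.
have d1 : 1 + tau != 0 by lra.
have d2 : delta + tau != 0 by lra.
rewrite addf_div//; apply: (canLR (mulfK _)); first by rewrite mulf_neq0.
by move: quad; rewrite /b => quad; nra.
Qed.

End TauSol.

(** * Asymptotics of the root on either side of [theta] *)

Section Regimes.
Context {R : realType} (kap delta : nat -> R) (theta : R).
Hypothesis theta_bnd : 0 < theta < 1.
Hypothesis kap_cvg : kap @ \oo --> theta.
Hypothesis delta_cvg0 : delta @ \oo --> 0.
Hypothesis delta_gt0 : \forall p \near \oo, 0 < delta p.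
Implicit Types (nu tau : nat -> R) (rho : R).

(** Here [kap] stands for [k / p] and [nu] for [n / p], so that teacher and student roots are both
    instances. *)
Definition df_root nu tau := \forall p \near \oo, 0 < tau p /\
  kap p / (1 + tau p) + (1 - kap p) * (delta p / (delta p + tau p)) = nu p.

(** Bounding [kap / (1 + tau)] by [kap] in the equation gives [delta / (delta + tau) >= lo], hence
    [tau <= delta / lo], which tends to 0 because [lo] has a positive limit. The equation is then
    solved for [delta / (delta + tau)]. *)
Lemma root_cvg_above nu rho tau :
  nu @ \oo --> rho -> theta < rho -> df_root nu tau ->
  tau @ \oo --> 0 /\
  (fun p => delta p / (delta p + tau p)) @ \oo
    --> ((rho - theta) / (1 - theta) : R).
Proof.
move=> nu_cvg theta_rho root; have /andP[theta0 theta1] := theta_bnd.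
pose lo p := (nu p - kap p) / (1 - kap p).
have lo_cvg : lo @ \oo --> ((rho - theta) / (1 - theta) : R).
  apply: cvgM; first exact: cvgB.
  by apply: cvgV; [lra|apply: cvgB; [exact: cvg_cst|]].
have lim_gt0 : 0 < (rho - theta) / (1 - theta) by rewrite divr_gt0// subr_gt0.
have tau_cvg : tau @ \oo --> 0.
  have hi_cvg : (fun p => delta p / lo p) @ \oo --> 0.
    rewrite -(mul0r ((rho - theta) / (1 - theta))^-1).
    by apply: cvgM => //; apply: cvgV => //; rewrite gt_eqF.
  apply: (squeeze_cvgr _ (cvg_cst 0) hi_cvg); near=> p.
  have d0 : 0 < delta p by near: p.
  have lo0 : 0 < lo p by near: p; exact: cvgr_gt lo_cvg _ lim_gt0.
  have k0 : 0 < kap p by near: p; exact: cvgr_gt kap_cvg _ theta0.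
  have k1 : kap p < 1 by near: p; exact: cvgr_lt kap_cvg _ theta1.
  have [t0 e] : 0 < tau p /\ kap p / (1 + tau p)
      + (1 - kap p) * (delta p / (delta p + tau p)) = nu p by near: p.
  have lo_le : lo p <= delta p / (delta p + tau p).
    rewrite ler_pdivrMr ?subr_gt0// mulrC -e.
    have : kap p / (1 + tau p) <= kap p by rewrite ler_pdivrMr; nra.
    by lra.
  rewrite (ltW t0)/= ler_pdivlMr//.
  move: lo_le; rewrite ler_pdivlMr ?addr_gt0// => lo_le.
  by nra.
split=> //.
have -> : (rho - theta) / (1 - theta) = (rho - theta / (1 + 0)) / (1 - theta).
  by rewrite addr0 divr1.
apply: (@cvg_trans _
    ((fun p => (nu p - kap p / (1 + tau p)) / (1 - kap p)) @ \oo)); last first.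
  apply: cvgM; last by apply: cvgV; [lra|apply: cvgB; [exact: cvg_cst|]].
  apply: cvgB => //; apply: cvgM => //; apply: cvgV; first lra.
  by apply: cvgD => //; exact: cvg_cst.
apply: near_eq_cvg; near=> p.
have k1 : kap p < 1 by near: p; exact: cvgr_lt kap_cvg _ theta1.
have [_ <-] : 0 < tau p /\ kap p / (1 + tau p)
    + (1 - kap p) * (delta p / (delta p + tau p)) = nu p by near: p.
by rewrite addrC addKr mulrC mulKf//; lra.
Unshelve. all: by end_near. Qed.

(** Dropping the positive [delta] term from the equation gives [tau >= lo], and [lo] has a positive
    limit; so [u <= delta / lo] tends to 0. The equation is then solved for [tau]. *)
Lemma root_cvg_below nu rho tau :
  nu @ \oo --> rho -> 0 < rho < theta -> df_root nu tau ->
  tau @ \oo --> (theta / rho - 1 : R).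
Proof.
move=> nu_cvg /andP[rho0 rho_theta] root.
have /andP[theta0 theta1] := theta_bnd.
pose lo p := kap p / nu p - 1.
have lo_cvg : lo @ \oo --> (theta / rho - 1 : R).
  apply: cvgB; last exact: cvg_cst.
  by apply: cvgM => //; apply: cvgV => //; lra.
have lim_gt0 : 0 < theta / rho - 1 by rewrite subr_gt0 ltr_pdivlMr// mul1r.
pose u p := delta p / (delta p + tau p).
have u_cvg : u @ \oo --> 0.
  have hi_cvg : (fun p => delta p / lo p) @ \oo --> 0.
    rewrite -(mul0r (theta / rho - 1)^-1).
    by apply: cvgM => //; apply: cvgV => //; rewrite gt_eqF.
  apply: (squeeze_cvgr _ (cvg_cst 0) hi_cvg); near=> p.
  have d0 : 0 < delta p by near: p.
  have lo0 : 0 < lo p by near: p; exact: cvgr_gt lo_cvg _ lim_gt0.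
  have nu0 : 0 < nu p by near: p; exact: cvgr_gt nu_cvg _ rho0.
  have k1 : kap p < 1 by near: p; exact: cvgr_lt kap_cvg _ theta1.
  have [t0 e] : 0 < tau p /\ kap p / (1 + tau p)
      + (1 - kap p) * (delta p / (delta p + tau p)) = nu p by near: p.
  have u0 : 0 < u p by rewrite divr_gt0// addr_gt0.
  have dt0 : 0 < delta p + tau p by rewrite addr_gt0.
  rewrite (ltW u0)/= ler_pM2l// lef_pV2 ?posrE//.
  suff : lo p <= tau p by lra.
  rewrite lerBlDr ler_pdivrMr// addrC -ler_pdivrMl; last lra.
  by rewrite mulrC -e lerDl; apply: mulr_ge0; [lra|exact: ltW].
apply: (@near_eq_cvgn _ (fun p => kap p / (nu p - (1 - kap p) * u p) - 1)
    _ (theta / (rho - (1 - theta) * 0) - 1)); first by rewrite mulr0 subr0.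
  near=> p.
  have k0 : 0 < kap p by near: p; exact: cvgr_gt kap_cvg _ theta0.
  have [t0 <-] : 0 < tau p /\ kap p / (1 + tau p)
      + (1 - kap p) * (delta p / (delta p + tau p)) = nu p by near: p.
  by rewrite addrK; field; lra.
apply: cvgB; last exact: cvg_cst.
apply: cvgM => //; apply: cvgV; first lra.
apply: cvgB => //; apply: cvgM => //.
by apply: cvgB => //; exact: cvg_cst.
Unshelve. all: by end_near. Qed.

End Regimes.

(** * Leading order in [delta] of the teacher coefficients *)

Section LeadingOrder.
Context {R : realType} (k : nat -> nat) (delta : nat -> R) (theta eta : R).
Hypothesis theta_bnd : 0 < theta < 1.
Hypothesis delta_bnd : forall p, (0 < p)%N -> 0 < delta p < 1.
Hypothesis k_cvg : ratio_cvg k theta.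
Hypothesis delta_cvg : (fun p => (p%:R - (k p)%:R) * delta p) @ \oo --> eta.

Local Notation kap := (fun p => (k p)%:R / p%:R : R).

Lemma near_gt0n : \forall p \near \oo, (0 < p)%N.
Proof. exact: nbhs_infty_gt. Qed.

Lemma delta_near_gt0 : \forall p \near \oo, 0 < delta p.
Proof. by apply: filterS near_gt0n => p /delta_bnd /andP[]. Qed.

(** The product [(p - k) delta] converges while [p - k] grows like [(1 - theta) p]. *)
Lemma delta_cvg0 : delta @ \oo --> 0.
Proof.
have /andP[theta0 theta1] := theta_bnd.
apply: (@near_eq_cvgn _
  (fun p => (p%:R - (k p)%:R) * delta p * p%:R^-1 / (1 - kap p)) _
  (eta * 0 / (1 - theta))); first by rewrite mulr0 mul0r.
  near=> p.
  have p0 : 0 < p%:R :> R by rewrite ltr0n; near: p; exact: near_gt0n.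
  have k1 : kap p < 1 by near: p; exact: cvgr_lt k_cvg _ theta1.
  have : (k p)%:R < p%:R :> R by move: k1; rewrite /= ltr_pdivrMr ?mul1r.
  by move=> ?; field; lra.
apply: cvgM; first by apply: cvgM => //; exact: invn_cvg0.
by apply: cvgV; [lra|apply: cvgB => //; exact: cvg_cst].
Unshelve. all: by end_near. Qed.

Lemma ratio_near_lt1 (n : nat -> nat) (rho : R) :
  ratio_cvg n rho -> rho < 1 -> \forall p \near \oo, (n p < p)%N.
Proof.
move=> n_cvg rho1; near=> p.
have p0 : 0 < p%:R :> R by rewrite ltr0n; near: p; exact: near_gt0n.
have : (n p)%:R / p%:R < 1 :> R by near: p; exact: cvgr_lt n_cvg _ rho1.
by rewrite ltr_pdivrMr// mul1r ltr_nat.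
Unshelve. all: by end_near. Qed.

Lemma ratio_near_lt (n n' : nat -> nat) (rho rho' : R) :
  ratio_cvg n rho -> ratio_cvg n' rho' -> rho < rho' ->
  \forall p \near \oo, (n p < n' p)%N.
Proof.
move=> n_cvg n'_cvg lt_rho; near=> p.
have p0 : 0 < p%:R :> R by rewrite ltr0n; near: p; exact: near_gt0n.
have : (n p)%:R / p%:R < (rho + rho') / 2 :> R.
  by near: p; apply: cvgr_lt n_cvg _ _; lra.
have : (rho + rho') / 2 < (n' p)%:R / p%:R :> R.
  by near: p; apply: cvgr_gt n'_cvg _ _; lra.
move=> /[swap] /lt_trans /[apply]; rewrite ltr_pM2r ?invr_gt0//.
by rewrite ltr_nat.
Unshelve. all: by end_near. Qed.

Lemma tau_sol_root (n : nat -> nat) (rho : R) :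
  pos_seq n -> ratio_cvg n rho -> rho < 1 ->
  df_root kap delta (fun p => (n p)%:R / p%:R)
    (fun p => tau_sol p (k p) (delta p) (n p)).
Proof.
move=> n_pos n_cvg rho1; rewrite /df_root; near=> p.
have p0 : (0 < p)%N by near: p; exact: near_gt0n.
have np : (0 < n p < p)%N.
  by rewrite n_pos//=; near: p; exact: ratio_near_lt1 n_cvg rho1.
have [tau0 e] := tau_solP (k p) np (delta_bnd p0).
by split=> //; rewrite -e dfE.
Unshelve. all: by end_near. Qed.

Lemma LambdaT_gt0 rhoT : 0 < rhoT < 1 -> rhoT != theta ->
  0 < LambdaT theta rhoT.
Proof.
move=> /andP[r0 r1] neq; have /andP[t0 t1] := theta_bnd.
rewrite /LambdaT; case: (ltgtP rhoT theta) neq => //= h _.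
  by rewrite subr_gt0.
by rewrite divr_gt0 ?mulr_gt0 ?subr_gt0.
Qed.

(* [V] is of order [delta] and [Lambda_T] is, up to the factor [1 - theta],
   the limit of [delta * S / V]. *)
Lemma teacher_cvg (NT : nat -> nat) (rhoT : R) :
  pos_seq NT -> ratio_cvg NT rhoT -> 0 < rhoT < 1 -> rhoT != theta ->
  exists2 v : R, 0 < v &
    (fun p => Vcoef p (k p) (NT p) (delta p) / delta p) @ \oo --> v /\
    (fun p => Scoef p (k p) (NT p) (delta p)) @ \oo
      --> (v * (LambdaT theta rhoT / (1 - theta)) : R).
Proof.
move=> NT_pos NT_cvg /andP[rho0 rho1] rho_neq.
have /andP[theta0 theta1] := theta_bnd.
have d_cvg := delta_cvg0.
pose tau p := tau_sol p (k p) (delta p) (NT p).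
have root : df_root kap delta (fun p => (NT p)%:R / p%:R) tau.
  exact: tau_sol_root NT_cvg rho1.
pose a p := (1 + tau p)^-1.
(* Since [S = a - V] and [V] is of order [delta], the limit of [S] is that of [a]. *)
suff [v [v0 a_cvg V_cvg]] : exists v : R, [/\ 0 < v,
    a @ \oo --> (v * (LambdaT theta rhoT / (1 - theta)) : R) &
    (fun p => Vcoef p (k p) (NT p) (delta p) / delta p) @ \oo --> v].
  exists v => //; split => //.
  apply: (@near_eq_cvgn _
    (fun p => a p - delta p * (Vcoef p (k p) (NT p) (delta p) / delta p)) _
    (v * (LambdaT theta rhoT / (1 - theta)) - 0 * v)).
  - by rewrite mul0r subr0.
  - near=> p.
    have NTp : (NT p < p)%N by near: p; exact: ratio_near_lt1 NT_cvg rho1.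
    have d0 : 0 < delta p by near: p; exact: delta_near_gt0.
    rewrite [delta p * _]mulrC divfK ?gt_eqF// /Scoef /Vcoef.
    by rewrite /acoef /tauT NTp.
  - by apply: cvgB => //; exact: cvgM.
(* Dividing by [p] inside [Theta] expresses [V] through [k / p], [delta] and [tau] alone. *)
have VE : \forall p \near \oo, exists2 kd, kd = kap p &
  [/\ 0 < kd < 1, 0 < delta p, 0 < tau p &
  Vcoef p (k p) (NT p) (delta p) =
  (a p - a p ^+ 2) * (1 + kd * (delta p + tau p) ^+ 2
    / ((1 - kd) * delta p * (1 + tau p) ^+ 2))^-1].
  near=> p; exists (kap p) => //.
  have p0 : 0 < p%:R :> R by rewrite ltr0n; near: p; exact: near_gt0n.
  have NTp : (NT p < p)%N by near: p; exact: ratio_near_lt1 NT_cvg rho1.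
  have d0 : 0 < delta p by near: p; exact: delta_near_gt0.
  have k0 : 0 < kap p by near: p; exact: cvgr_gt k_cvg _ theta0.
  have k1 : kap p < 1 by near: p; exact: cvgr_lt k_cvg _ theta1.
  have [t0 _] : 0 < tau p /\ kap p / (1 + tau p)
      + (1 - kap p) * (delta p / (delta p + tau p)) = (NT p)%:R / p%:R.
    by near: p.
  have kp : (k p)%:R < p%:R :> R by move: k1; rewrite /= ltr_pdivrMr ?mul1r.
  rewrite k0 k1; split => //.
  rewrite /Vcoef /ccoef /Theta /acoef /tauT NTp -/(tau p) -/(a p).
  by do 3 congr (_ _); field; lra.
move: rho_neq; rewrite /LambdaT; case: (ltgtP rhoT theta) => // rho_theta _.
(* Here [tau] has a positive limit, so [c] does too, and the factor [delta] of [V] comes from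
   [Theta]. The value of [v] is forced by the limit [rhoT / theta] of [a]. *)
- have rho_bnd : 0 < rhoT < theta by rewrite rho0.
  have tau_cvg :=
    root_cvg_below theta_bnd k_cvg d_cvg delta_near_gt0 NT_cvg rho_bnd root.
  have lim0 : 0 < theta / rhoT - 1 by rewrite subr_gt0 ltr_pdivlMr// mul1r.
  have a_cvg : a @ \oo --> ((1 + (theta / rhoT - 1))^-1 : R).
    by apply: cvgV; [lra|apply: cvgD => //; exact: cvg_cst].
  have limE : (1 + (theta / rhoT - 1))^-1 = rhoT / theta.
    by rewrite addrC subrK invf_div.
  exists (rhoT / theta * ((1 - theta) / (theta - rhoT))); split.
  + by rewrite mulr_gt0 ?divr_gt0//; lra.
  + apply: near_eq_cvgn a_cvg; last exact: nearW.
    by rewrite limE; field; lra.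
  + rewrite limE in a_cvg.
    pose l := theta / rhoT - 1.
    apply: (@near_eq_cvgn _ (fun p => (a p - a p * a p) *
      (delta p + kap p * ((delta p + tau p) * (delta p + tau p))
                 * (a p * a p) / (1 - kap p))^-1) _
      ((rhoT / theta - rhoT / theta * (rhoT / theta)) *
        (0 + theta * ((0 + l) * (0 + l)) * (rhoT / theta * (rhoT / theta))
             / (1 - theta))^-1)).
    * by rewrite /l; field; lra.
    * near=> p.
      have [_ -> [/andP[k0 k1] d0 t0 ->]] : exists2 kd, kd = kap p &
        [/\ 0 < kd < 1, 0 < delta p, 0 < tau p &
        Vcoef p (k p) (NT p) (delta p) =
        (a p - a p ^+ 2) * (1 + kd * (delta p + tau p) ^+ 2
          / ((1 - kd) * delta p * (1 + tau p) ^+ 2))^-1] by near: p.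
      rewrite /a; move: k0 k1 d0 t0 => /=.
      move: (_ / p%:R) (delta p) (tau p) => kp d t k0 k1 d0 t0.
      have := mulr_gt0 k0 (exprn_gt0 2 (addr_gt0 d0 t0)).
      have : 0 < (1 - kp) * d * (1 + t) ^+ 2.
        by rewrite !mulr_gt0 ?exprn_gt0 ?subr_gt0 ?addr_gt0//.
      by move=> ? ?; field; lra.
    * have l_gt0 : 0 < theta * (l * l) * (rhoT / theta * (rhoT / theta))
                       / (1 - theta).
        have l0 : 0 < l by [].
        apply: divr_gt0; last by rewrite subr_gt0.
        by rewrite !mulr_gt0// invr_gt0.
      apply: cvgM; first by apply: cvgB => //; exact: cvgM.
      apply: cvgV; first by rewrite !add0r gt_eqF.
      apply: cvgD => //; apply: cvgM.
        apply: cvgM; last exact: cvgM.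
        by apply: cvgM => //; apply: cvgM; exact: cvgD.
      by apply: cvgV; [lra|apply: cvgB => //; exact: cvg_cst].
(* Here [tau] tends to 0, so [a] and [Theta] tend to 1, and the factor [delta] of [V] comes from
   [c = a ^ 2 tau]. Thus [v] is the limit of [tau / delta]. *)
- have [tau_cvg u_cvg] :=
    root_cvg_above theta_bnd k_cvg d_cvg delta_near_gt0 NT_cvg rho_theta root.
  set u0 := (rhoT - theta) / (1 - theta) in u_cvg.
  have u0_gt0 : 0 < u0 by rewrite divr_gt0// subr_gt0.
  have a_cvg : a @ \oo --> ((1 + 0)^-1 : R).
    by apply: cvgV; [lra|apply: cvgD => //; exact: cvg_cst].
  exists ((1 - rhoT) / (rhoT - theta)); split.
  + by rewrite divr_gt0 ?subr_gt0.
  + apply: near_eq_cvgn a_cvg; last exact: nearW.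
    by field; lra.
  + pose u p := delta p / (delta p + tau p).
    rewrite addr0 invr1 in a_cvg.
    apply: (@near_eq_cvgn _ (fun p => a p * a p * ((u p)^-1 - 1) *
      (1 + kap p * (a p * a p) * (delta p * (u p)^-1 * (u p)^-1)
           / (1 - kap p))^-1) _
      (1 * 1 * (u0^-1 - 1) *
        (1 + theta * (1 * 1) * (0 * u0^-1 * u0^-1) / (1 - theta))^-1)).
    * by rewrite /u0; field; lra.
    * near=> p.
      have [_ -> [/andP[k0 k1] d0 t0 ->]] : exists2 kd, kd = kap p &
        [/\ 0 < kd < 1, 0 < delta p, 0 < tau p &
        Vcoef p (k p) (NT p) (delta p) =
        (a p - a p ^+ 2) * (1 + kd * (delta p + tau p) ^+ 2
          / ((1 - kd) * delta p * (1 + tau p) ^+ 2))^-1] by near: p.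
      rewrite /a /u; move: k0 k1 d0 t0 => /=.
      move: (_ / p%:R) (delta p) (tau p) => kp d t k0 k1 d0 t0.
      have := mulr_gt0 k0 (exprn_gt0 2 (addr_gt0 d0 t0)).
      have : 0 < (1 - kp) * d * (1 + t) ^+ 2.
        by rewrite !mulr_gt0 ?exprn_gt0 ?subr_gt0 ?addr_gt0//.
      by move=> ? ?; field; lra.
    * have uV_cvg : (fun p => (u p)^-1) @ \oo --> u0^-1.
        by apply: cvgV => //; rewrite gt_eqF.
      have aa_cvg : (fun p => a p * a p) @ \oo --> (1 * 1 : R) by exact: cvgM.
      apply: cvgM.
        by apply: cvgM => //; apply: cvgB => //; exact: cvg_cst.
      apply: cvgV; first by rewrite !mul0r mulr0 mul0r addr0 oner_eq0.
      apply: cvgD; first exact: cvg_cst.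
      apply: cvgM.
        apply: cvgM; first exact: cvgM.
        by apply: cvgM => //; exact: cvgM.
      by apply: cvgV; [lra|apply: cvgB => //; exact: cvg_cst].
Unshelve. all: by end_near. Qed.

(** * Limit of the gain over [delta] in each bottleneck regime *)

Section Student.
Context (NT m NS : nat -> nat) (rhoT rhom rhoS : R).
Hypothesis NT_pos : pos_seq NT.
Hypothesis m_pos : pos_seq m.
Hypothesis NS_pos : pos_seq NS.
Hypothesis NT_cvg : ratio_cvg NT rhoT.
Hypothesis m_cvg : ratio_cvg m rhom.
Hypothesis NS_cvg : ratio_cvg NS rhoS.
Hypothesis rhoT_bnd : 0 < rhoT < 1.
Hypothesis rhoT_theta : rhoT != theta.

Local Notation Lam := (LambdaT theta rhoT).

Definition feature_sign : R :=
  2 * (rhoS - theta) * (rhom - rhoS) - rhom * (Lam + rhoS - theta).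

Definition sample_sign : R :=
  (rhom - 2 * theta) * (rhoS - rhom) - rhom * (Lam + rhom - theta).

(** With [V = w delta] and [tau / delta = 1 / u - 1], a factor [1 / u - 1] comes out of the whole
    quotient. What remains is continuous in quantities with known limits. *)
Lemma feature_cvg : theta < rhoS -> rhoS < 1 -> rhoS < rhom ->
  exists2 C : R, 0 < C &
  (fun p => W2SG p (k p) (NT p) (NS p) (m p) (delta p) / delta p) @ \oo
    --> (C * feature_sign : R).
Proof.
move=> theta_S S1 Sm; have /andP[theta0 theta1] := theta_bnd.
have [v v0 [w_cvg S_cvg]] := teacher_cvg NT_pos NT_cvg rhoT_bnd rhoT_theta.
have d_cvg := delta_cvg0.
pose tau p := tau_sol p (k p) (delta p) (NS p).
have root := tau_sol_root NS_pos NS_cvg S1.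
have [tau_cvg u_cvg] :=
  root_cvg_above theta_bnd k_cvg d_cvg delta_near_gt0 NS_cvg theta_S root.
pose w p := Vcoef p (k p) (NT p) (delta p) / delta p.
pose S p := Scoef p (k p) (NT p) (delta p).
pose u p := delta p / (delta p + tau p).
pose u0 := (rhoS - theta) / (1 - theta).
have u0_gt0 : 0 < u0 by rewrite divr_gt0// subr_gt0.
(* The first quotient is the limit of [1 / u - 1]; the last denominator is the one cleared in
   passing to [feature_sign]. *)
exists ((1 - rhoS) / (rhoS - theta) * v / ((1 - theta) * (rhom - rhoS))).
  by rewrite !(divr_gt0, mulr_gt0)// ?mulr_gt0 ?subr_gt0.
apply: (@near_eq_cvgn _ (fun p => ((u p)^-1 - 1) *
  (2 * w p * (u p - delta p * (1 + tau p)^-1)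
   - (S p * (1 + tau p)^-1 + w p * u p)
     / (1 - (NS p)%:R / p%:R / ((m p)%:R / p%:R)))) _
  ((u0^-1 - 1) * (2 * v * (u0 - 0 * (1 + 0)^-1)
   - (v * (Lam / (1 - theta)) * (1 + 0)^-1 + v * u0)
     / (1 - rhoS / rhom)))).
- by rewrite /feature_sign /u0; field; lra.
- near=> p.
  have p0 : (0 < p)%N by near: p; exact: near_gt0n.
  have d0 : 0 < delta p by near: p; exact: delta_near_gt0.
  have NSp : (NS p < p)%N by near: p; exact: ratio_near_lt1 NS_cvg S1.
  have NSm : (NS p < m p)%N by near: p; exact: ratio_near_lt NS_cvg m_cvg Sm.
  have [t0 _] : 0 < tau p /\ kap p / (1 + tau p)
      + (1 - kap p) * (delta p / (delta p + tau p)) = (NS p)%:R / p%:R.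
    by near: p.
  rewrite /W2SG /Mterm /tauS.
  have -> : (p < minn (m p) (NS p))%N = false.
    by rewrite leq_min [(p < NS p)%N]ltnNge (ltnW NSp) andbF.
  rewrite leq_min NSm NSp /= -/(tau p) /T1 /Delta -/(S p).
  have -> : Vcoef p (k p) (NT p) (delta p) = w p * delta p.
    by rewrite /w divfK// gt_eqF.
  have p0' : 0 < p%:R :> R by rewrite ltr0n.
  have n0 : 0 < (NS p)%:R :> R by rewrite ltr0n NS_pos.
  have nm : (NS p)%:R < (m p)%:R :> R by rewrite ltr_nat.
  rewrite /u; move: (w p) (S p) (tau p) (delta p) t0 d0 n0 nm p0'.
  move: (NS p)%:R (m p)%:R p%:R => n' m' p'.
  move=> w' S' t d t0 d0 n0 nm p0'.
  by field; lra.
- have uV : (fun p => (u p)^-1) @ \oo --> (u0^-1 : R).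
    by apply: cvgV => //; rewrite gt_eqF.
  have aV : (fun p => (1 + tau p)^-1) @ \oo --> ((1 + 0)^-1 : R).
    by apply: cvgV; [lra|apply: cvgD => //; exact: cvg_cst].
  apply: cvgM; first by apply: cvgB => //; exact: cvg_cst.
  apply: cvgB.
    apply: cvgM; first by apply: cvgM => //; exact: cvg_cst.
    by apply: cvgB => //; exact: cvgM.
  apply: cvgM; first by apply: cvgD; exact: cvgM.
  apply: cvgV.
    by rewrite subr_eq0 eq_sym; apply/eqP => /divr1_eq; lra.
  apply: cvgB; first exact: cvg_cst.
  by apply: cvgM => //; apply: cvgV => //; lra.
Unshelve. all: by end_near. Qed.

(** The same factor [1 / u - 1] comes out. In the [T2] term, the part in [S] keeps a factor [delta]
    and vanishes; the part in [V] tends to [v rhom / (1 - theta)], which turns the coefficient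
    [2 (rhom - theta)] of the feature regime into the slope [rhom - 2 theta]. *)
Lemma sample_cvg : theta < rhom -> rhom < 1 -> rhom < rhoS ->
  exists2 C : R, 0 < C &
  (fun p => W2SG p (k p) (NT p) (NS p) (m p) (delta p) / delta p) @ \oo
    --> (C * sample_sign : R).
Proof.
move=> theta_m m1 mS; have /andP[theta0 theta1] := theta_bnd.
have [v v0 [w_cvg S_cvg]] := teacher_cvg NT_pos NT_cvg rhoT_bnd rhoT_theta.
have d_cvg := delta_cvg0.
pose tau p := tau_sol p (k p) (delta p) (m p).
have root := tau_sol_root m_pos m_cvg m1.
have [tau_cvg u_cvg] :=
  root_cvg_above theta_bnd k_cvg d_cvg delta_near_gt0 m_cvg theta_m root.
pose w p := Vcoef p (k p) (NT p) (delta p) / delta p.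
pose S p := Scoef p (k p) (NT p) (delta p).
pose a p := (1 + tau p)^-1.
pose u p := delta p / (delta p + tau p).
pose u0 := (rhom - theta) / (1 - theta).
have u0_gt0 : 0 < u0 by rewrite divr_gt0// subr_gt0.
exists ((1 - rhom) / (rhom - theta) * v / ((1 - theta) * (rhoS - rhom))).
  by rewrite !(divr_gt0, mulr_gt0)// ?mulr_gt0 ?subr_gt0.
pose den p := 1 - (kap p * (a p * a p) + (1 - kap p) * (u p * u p))
                 / ((m p)%:R / p%:R).
have a_cvg : a @ \oo --> ((1 + 0)^-1 : R).
  by apply: cvgV; [lra|apply: cvgD => //; exact: cvg_cst].
rewrite addr0 invr1 in a_cvg.
pose den0 := 1 - (theta * (1 * 1) + (1 - theta) * (u0 * u0)) / rhom.
have den_cvg : den @ \oo --> den0.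
  apply: cvgB; first exact: cvg_cst.
  apply: cvgM; last by apply: cvgV => //; lra.
  apply: cvgD; first by apply: cvgM => //; exact: cvgM.
  apply: cvgM; last exact: cvgM.
  by apply: cvgB => //; exact: cvg_cst.
have den0E : den0 = (rhom - theta) * (1 - rhom) / ((1 - theta) * rhom).
  by rewrite /den0 /u0; field; lra.
(* This keeps the denominator of the [T2] term away from 0 for large [p]. *)
have den0_gt0 : 0 < den0.
  by rewrite den0E divr_gt0 ?mulr_gt0 ?subr_gt0//; lra.
apply: (@near_eq_cvgn _ (fun p => ((u p)^-1 - 1) *
  (2 * w p * (u p - delta p * a p)
   - ((u p)^-1 - 1) * (delta p * S p * (a p * a p) + w p * (u p * u p))
     / den p
   - (S p * a p + w p * u p) * ((m p)%:R / p%:R)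
     / ((NS p)%:R / p%:R - (m p)%:R / p%:R))) _
  ((u0^-1 - 1) * (2 * v * (u0 - 0 * 1)
   - (u0^-1 - 1) * (0 * (v * (Lam / (1 - theta))) * (1 * 1) + v * (u0 * u0))
     / den0
   - (v * (Lam / (1 - theta)) * 1 + v * u0) * rhom / (rhoS - rhom)))).
- by rewrite den0E /sample_sign /u0; field; lra.
- near=> p.
  have p0 : (0 < p)%N by near: p; exact: near_gt0n.
  have d0 : 0 < delta p by near: p; exact: delta_near_gt0.
  have mp : (m p < p)%N by near: p; exact: ratio_near_lt1 m_cvg m1.
  have mNS : (m p < NS p)%N by near: p; exact: ratio_near_lt m_cvg NS_cvg mS.
  have [t0 _] : 0 < tau p /\ kap p / (1 + tau p)
      + (1 - kap p) * (delta p / (delta p + tau p)) = (m p)%:R / p%:R.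
    by near: p.
  have den_neq0 : den p != 0.
    by rewrite gt_eqF//; near: p; exact: cvgr_gt den_cvg _ den0_gt0.
  rewrite /W2SG /Mterm /tauS.
  have -> : (p < minn (m p) (NS p))%N = false.
    by rewrite leq_min [(p < m p)%N]ltnNge (ltnW mp).
  have -> : (NS p < minn (m p) p)%N = false.
    by rewrite leq_min [(NS p < m p)%N]ltnNge (ltnW mNS).
  rewrite leq_min mNS mp /= -/(tau p) /T1 /T2 /Delta -/(S p).
  have -> : Vcoef p (k p) (NT p) (delta p) = w p * delta p.
    by rewrite /w divfK// gt_eqF.
  have p0' : 0 < p%:R :> R by rewrite ltr0n.
  have m0 : 0 < (m p)%:R :> R by rewrite ltr0n m_pos.
  have nm : (m p)%:R < (NS p)%:R :> R by rewrite ltr_nat.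
  have -> : 1 - p%:R / (m p)%:R * df2 p (k p) (delta p) (tau p) = den p.
    rewrite df2E// /den /a !expr2 /u; congr (1 - _).
    by rewrite [LHS]mulrC invf_div invfM.
  rewrite /a /u.
  move: (den p) (w p) (S p) (tau p) (delta p) den_neq0 t0 d0 m0 nm p0'.
  move: (NS p)%:R (m p)%:R p%:R => n' m' p'.
  move=> e w' S' t d e0 t0 d0 m0 nm p0'.
  by field; lra.
- have uV : (fun p => (u p)^-1) @ \oo --> (u0^-1 : R).
    by apply: cvgV => //; rewrite gt_eqF.
  have uV1 : (fun p => (u p)^-1 - 1) @ \oo --> (u0^-1 - 1 : R).
    by apply: cvgB => //; exact: cvg_cst.
  have aa : (fun p => a p * a p) @ \oo --> (1 * 1 : R) by exact: cvgM.
  have uu : (fun p => u p * u p) @ \oo --> (u0 * u0 : R) by exact: cvgM.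
  apply: cvgM => //; apply: cvgB.
    apply: cvgB.
      apply: cvgM; first by apply: cvgM => //; exact: cvg_cst.
      by apply: cvgB => //; exact: cvgM.
    apply: cvgM; last by apply: cvgV => //; rewrite gt_eqF.
    apply: cvgM => //; apply: cvgD; last exact: cvgM.
    by apply: cvgM => //; exact: cvgM.
  apply: cvgM; last by apply: cvgV; [lra|exact: cvgB].
  by apply: cvgM => //; apply: cvgD; exact: cvgM.
Unshelve. all: by end_near. Qed.

End Student.

End LeadingOrder.

(** * From sequences of widths to limiting ratios *)

Section Openness.
Context {R : realType}.

(** The successor of the integer part keeps every term positive, even for [r = 0], and costs at most
    [1 / p] in the ratio. *)
Lemma ratio_cvg_exists (r : R) : 0 <= r ->
  exists2 n : nat -> nat, pos_seq n & ratio_cvg n r.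
Proof.
move=> r0; exists (fun p => (Num.trunc (r * p%:R)).+1) => //.
have hi_cvg : (fun p => r + p%:R^-1 : R) @ \oo --> r.
  apply: (@near_eq_cvgn _ (fun p => r + p%:R^-1 : R) _ (r + 0)).
  - by rewrite addr0.
  - exact: nearW.
  - by apply: cvgD; [exact: cvg_cst|exact: invn_cvg0].
apply: (squeeze_cvgr _ (cvg_cst r) hi_cvg); near=> p.
have p0 : 0 < p%:R :> R by rewrite ltr0n; near: p; exact: nbhs_infty_gt.
have /andP[lo hi] := truncn_itv (mulr_ge0 r0 (ltW p0)).
rewrite ler_pdivlMr// ltW//= ler_pdivrMr// mulrDl mulVf ?gt_eqF//.
by rewrite -natr1 lerD2r.
Unshelve. all: by end_near. Qed.

(* Otherwise one picks, for each [j], a violation [(q j, N j)] with [q j >= j]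
   and ratio within [1 / (j + 1)] of [r]; a sequence through all of them still
   has ratio tending to [r], because only finitely many [q j] come from small
   [j]. *)
Lemma ratio_cvg_near (P : nat -> nat -> Prop) (r : R) : 0 <= r ->
  (forall n, pos_seq n -> ratio_cvg n r -> \forall p \near \oo, P p (n p)) ->
  exists2 e : R, 0 < e & forall r', `|r' - r| < e ->
    forall n, pos_seq n -> ratio_cvg n r' -> \forall p \near \oo, P p (n p).
Proof.
move=> r0 Pr.
(* A threshold and a radius uniform over all pairs [(p, N)] suffice: a sequence with limit ratio
   [r'] in the ball eventually has its ratios in the ball. *)
suff [e e0 [q Pe]] : exists2 e : R, 0 < e & exists q, forall p N,
    (q <= p)%N -> (0 < N)%N -> `|N%:R / p%:R - r| < e -> P p N.
  exists e => // r' r'e n n_pos n_cvg; near=> p.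
  have p0 : (0 < p)%N by near: p; exact: nbhs_infty_gt.
  have qp : (q <= p)%N by near: p; exact: nbhs_infty_ge.
  apply: Pe => //; first exact: n_pos.
  have : `|r' - (n p)%:R / p%:R| < e - `|r' - r|.
    by near: p; move/cvgrPdist_lt: n_cvg; apply; rewrite subr_gt0.
  rewrite ltrBrDr; apply: le_lt_trans.
  rewrite [`|r' - _ / _|]distrC.
  have -> : (n p)%:R / p%:R - r = ((n p)%:R / p%:R - r') + (r' - r) by ring.
  exact: ler_normD.
apply: contrapT => notP.
have violation j : exists qN : nat * nat, [/\ (j <= qN.1)%N, (0 < qN.2)%N,
    `|qN.2%:R / qN.1%:R - r| < j.+1%:R^-1 & ~ P qN.1 qN.2].
  apply: contrapT => noviol; apply: notP.
  exists (j.+1%:R^-1); first by rewrite invr_gt0 ltr0n.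
  exists j => p N jp N0 Np; apply: contrapT => notPpN; apply: noviol.
  by exists (p, N).
have [qN viol] := choice violation.
have [n0 n0_pos n0_cvg] := ratio_cvg_exists r0.
(* At indices carrying no violation the sequence follows [n0], whose ratio tends to [r]. *)
have pick p : exists N, (exists2 j, (qN j).1 = p & (qN j).2 = N) \/
    ((forall j, (qN j).1 <> p) /\ N = n0 p).
  have [[j qj]|none] := pselect (exists j, (qN j).1 = p).
    by exists (qN j).2; left; exists j.
  by exists (n0 p); right; split=> // j qj; apply: none; exists j.
have [n nP] := choice pick.
have n_pos : pos_seq n.
  move=> p p0; case: (nP p) => [[j _ <-]|[_ ->]]; last exact: n0_pos.
  by case: (viol j).
have n_cvg : ratio_cvg n r.
  apply/cvgrPdist_lt => e e0.
  have [J _ Je] : \forall j \near \oo, j.+1%:R^-1 < e.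
    exact: cvgr_lt (@cvg_harmonic R) _ e0.
  near=> p.
  have big : (\max_(j < J) (qN j).1 < p)%N.
    by near: p; exact: nbhs_infty_gt.
  case: (nP p) => [[j qj <-]|[_ ->]]; last first.
    by near: p; move/cvgrPdist_lt: n0_cvg; apply.
  have Jj : (J <= j)%N.
    rewrite leqNgt; apply/negP => jJ; move: big; rewrite ltnNge => /negP; apply.
    by rewrite -qj (leq_bigmax (Ordinal jJ)).
  have [_ _ dist _] := viol j.
  by rewrite distrC -qj; apply: lt_trans dist _; exact: Je.
have [q _ Pq] := Pr n n_pos n_cvg.
have [q_le _ _ notP'] := viol q.
(* Several violations may share a first component; whichever [j] was picked there contradicts
   [P]. *)
have := Pq _ q_le; case: (nP (qN q).1) => [[j qj <-]|[none _]].
  by rewrite -qj => ?; case: (viol j).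
by case: (none q).
Unshelve. all: by end_near. Qed.

(** Nothing is concluded for [s = 0], where the leading order does not decide the sign. *)
Lemma cvg_pos_sign (f d : nat -> R) (C s : R) : 0 < C ->
  (\forall p \near \oo, 0 < d p) ->
  (fun p => f p / d p) @ \oo --> (C * s : R) ->
  (0 < s -> \forall p \near \oo, 0 < f p) /\
  (s < 0 -> ~ \forall p \near \oo, 0 < f p).
Proof.
move=> C0 d0 f_cvg; split=> s0.
  have Cs : 0 < C * s by rewrite mulr_gt0.
  near=> p.
  have dp : 0 < d p by near: p.
  have : 0 < f p / d p by near: p; exact: cvgr_gt f_cvg _ Cs.
  by rewrite pmulr_lgt0 ?invr_gt0.
have Cs : C * s < 0 by rewrite pmulr_rlt0.
move=> f0; have [p [fp [dp]]] : exists p, 0 < f p /\ 0 < d p /\ f p / d p < 0.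
  apply: (@filter_ex _ \oo); apply: filterI => //; apply: filterI => //.
  exact: cvgr_lt f_cvg _ Cs.
by rewrite pmulr_llt0 ?invr_gt0// => /(lt_trans fp); rewrite ltxx.
Unshelve. all: by end_near. Qed.

End Openness.

(** * Sign analysis in [rhoS] *)

Theorem corollary5p6 (R : realType)
  (k NT m : nat -> nat) (delta : nat -> R)
  (theta eta rhoT rhom rhoS : R)
  (k_pos : pos_seq k) (NT_pos : pos_seq NT) (m_pos : pos_seq m)
  (delta_bnd : forall p, (0 < p)%N -> 0 < delta p < 1)
  (k_cvg : ratio_cvg k theta)
  (delta_cvg : (fun p => (p%:R - (k p)%:R) * delta p) @ \oo --> eta)
  (NT_cvg : ratio_cvg NT rhoT)
  (m_cvg : ratio_cvg m rhom)
  (theta_bnd : 0 < theta < 1) (rhoT_bnd : 0 < rhoT < 1) (eta_gt0 : 0 < eta)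
  (rhom_gt0 : 0 < rhom) (rhoS_gt0 : 0 < rhoS)
  (rhoT_theta : rhoT != theta) (rhom_rhoS : rhom != rhoS)
  (rhom_theta : rhom != theta) (rhoS_theta : rhoS != theta)
  (rhom_1 : rhom != 1) (rhoS_1 : rhoS != 1)
  (theta_lt_rhom : theta < rhom) :
  (* feature bottleneck *)
  (theta < rhoS < Num.min 1 rhom ->
     (0 < DS theta rhoT rhom ->
        (W2SG_pos k NT m delta rhoS <->
           rhoS_lo theta rhoT rhom < rhoS < rhoS_hi theta rhoT rhom
           /\ theta < rhoS < Num.min 1 rhom)
        (* off the endpoints, the same for each individual sequence *)
        /\ (rhoS != rhoS_lo theta rhoT rhom ->
            rhoS != rhoS_hi theta rhoT rhom ->
            forall NS : nat -> nat, pos_seq NS -> ratio_cvg NS rhoS ->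
              (W2SG_eventually_pos k NT NS m delta <->
                 rhoS_lo theta rhoT rhom < rhoS < rhoS_hi theta rhoT rhom
                 /\ theta < rhoS < Num.min 1 rhom)))
     /\ (DS theta rhoT rhom <= 0 ->
        ~ W2SG_pos k NT m delta rhoS
        (* off the double root, the same for each individual sequence *)
        /\ (DS theta rhoT rhom < 0 \/ rhoS != (rhom + 2 * theta) / 4 ->
            forall NS : nat -> nat, pos_seq NS -> ratio_cvg NS rhoS ->
              ~ W2SG_eventually_pos k NT NS m delta)))
  /\
  (* sample bottleneck *)
  (theta < rhom < Num.min 1 rhoS ->
     (rhom <= 2 * theta ->
        ~ W2SG_pos k NT m delta rhoS
        /\ (forall NS : nat -> nat, pos_seq NS -> ratio_cvg NS rhoS ->
              ~ W2SG_eventually_pos k NT NS m delta))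
     /\ (2 * theta < rhom ->
        (W2SG_pos k NT m delta rhoS <-> rhoS_threshold theta rhoT rhom < rhoS)
        (* off the threshold, the same for each individual sequence *)
        /\ (rhoS != rhoS_threshold theta rhoT rhom ->
            forall NS : nat -> nat, pos_seq NS -> ratio_cvg NS rhoS ->
              (W2SG_eventually_pos k NT NS m delta <->
                 rhoS_threshold theta rhoT rhom < rhoS)))).
Proof.
have /andP[theta0 theta1] := theta_bnd.
have Lam0 := LambdaT_gt0 theta_bnd rhoT_bnd rhoT_theta.
have d_gt0 := delta_near_gt0 delta_bnd.
(* The ratio [r] is left free because the sign is also needed at perturbations of [rhoS]. *)
have feature r NS : theta < r -> r < 1 -> r < rhom ->
    pos_seq NS -> ratio_cvg NS r ->
    (0 < feature_sign theta rhoT rhom r -> W2SG_eventually_pos k NT NS m delta)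
    /\ (feature_sign theta rhoT rhom r < 0 ->
        ~ W2SG_eventually_pos k NT NS m delta).
  move=> r0 r1 r2 NS_pos NS_cvg.
  have [C C0 lim] := feature_cvg theta_bnd delta_bnd k_cvg delta_cvg NT_pos
    NS_pos NT_cvg m_cvg NS_cvg rhoT_bnd rhoT_theta r0 r1 r2.
  exact: cvg_pos_sign C0 d_gt0 lim.
have sample r NS : rhom < 1 -> rhom < r -> pos_seq NS -> ratio_cvg NS r ->
    (0 < sample_sign theta rhoT rhom r -> W2SG_eventually_pos k NT NS m delta)
    /\ (sample_sign theta rhoT rhom r < 0 ->
        ~ W2SG_eventually_pos k NT NS m delta).
  move=> r1 r2 NS_pos NS_cvg.
  have [C C0 lim] := sample_cvg theta_bnd delta_bnd k_cvg delta_cvg NT_pos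
    m_pos NT_cvg m_cvg NS_cvg rhoT_bnd rhoT_theta theta_lt_rhom r1 r2.
  exact: cvg_pos_sign C0 d_gt0 lim.
have W2SG_pos_open : W2SG_pos k NT m delta rhoS -> exists2 e : R, 0 < e &
    forall r', `|r' - rhoS| < e -> W2SG_pos k NT m delta r'.
  exact: (@ratio_cvg_near _
    (fun p N => 0 < W2SG p (k p) (NT p) N (m p) (delta p)) _ (ltW rhoS_gt0)).
split.
- rewrite lt_min => /andP[theta_S /andP[S1 Sm]].
  pose X := 4 * rhoS - (rhom + 2 * theta).
  (* Completing the square; [X] is, up to the factor 4, the offset of [rhoS] from the vertex. *)
  have signE r : 8 * feature_sign theta rhoT rhom r =
      DS theta rhoT rhom - (4 * r - (rhom + 2 * theta)) ^+ 2.
    by rewrite /feature_sign /DS; ring.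
  (* If the sign is negative all along one side of [rhoS], a small enough shift [t] stays both in
     the branch and in the ball where positivity would persist, a contradiction. *)
  have neg_near sgn : (sgn = 1 \/ sgn = -1) ->
      (forall t, 0 < t -> feature_sign theta rhoT rhom (rhoS + sgn * t) < 0) ->
      ~ W2SG_pos k NT m delta rhoS.
    move=> sgnE neg /W2SG_pos_open[e e0 pos].
    pose t := Num.min (Num.min e (rhoS - theta))
                      (Num.min (1 - rhoS) (rhom - rhoS)) / 2.
    have [t0 te tt t1 tm] : [/\ 0 < t, t < e, t < rhoS - theta, t < 1 - rhoS &
        t < rhom - rhoS].
      have min0 : 0 < t by rewrite divr_gt0// !lt_min !subr_gt0 e0 theta_S S1.
      have le_t : [/\ 2 * t <= e, 2 * t <= rhoS - theta, 2 * t <= 1 - rhoS &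
          2 * t <= rhom - rhoS].
        by rewrite /t mulrC divfK// !ge_min !lexx !orbT.
      by case: le_t => *; split; lra.
    pose r := rhoS + sgn * t.
    have [rt r1 rm] : [/\ theta < r, r < 1 & r < rhom].
      by rewrite /r; case: sgnE => ->; split; lra.
    have [NS NS_pos NS_cvg] := ratio_cvg_exists (ltW (lt_trans theta0 rt)).
    have [_] := feature _ _ rt r1 rm NS_pos NS_cvg; apply; first exact: neg.
    apply: pos NS_pos NS_cvg.
    have -> : r - rhoS = sgn * t by rewrite /r; ring.
    rewrite normrM [`|t|]gtr0_norm//.
    by case: sgnE => ->; rewrite ?normrN normr1 mul1r.
  split=> [D0|D0].
  + have s0 : 0 < Num.sqrt (DS theta rhoT rhom) by rewrite sqrtr_gt0.
    have sD : Num.sqrt (DS theta rhoT rhom) ^+ 2 = DS theta rhoT rhom.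
      by rewrite sqr_sqrtr// ltW.
    rewrite /rhoS_lo /rhoS_hi; set s := Num.sqrt _ in s0 sD *.
    have signX r : 8 * feature_sign theta rhoT rhom r =
        (s - (4 * r - (rhom + 2 * theta))) * (s + (4 * r - (rhom + 2 * theta))).
      by rewrite signE -sD; ring.
    clearbody s.
    have inside :
        (rhom + 2 * theta - s) / 4 < rhoS < (rhom + 2 * theta + s) / 4 ->
        0 < feature_sign theta rhoT rhom rhoS.
      move=> /andP[lo hi].
      have h1 : 0 < s - (4 * rhoS - (rhom + 2 * theta)) by lra.
      have h2 : 0 < s + (4 * rhoS - (rhom + 2 * theta)) by lra.
      by have := mulr_gt0 h1 h2; rewrite -signX; lra.
    have below r : r < (rhom + 2 * theta - s) / 4 ->
        feature_sign theta rhoT rhom r < 0.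
      move=> lo; have h1 : 0 < s - (4 * r - (rhom + 2 * theta)) by lra.
      have h2 : 0 < - (s + (4 * r - (rhom + 2 * theta))) by lra.
      by have := mulr_gt0 h1 h2; rewrite mulrN -signX; lra.
    have above r : (rhom + 2 * theta + s) / 4 < r ->
        feature_sign theta rhoT rhom r < 0.
      move=> hi; have h1 : 0 < - (s - (4 * r - (rhom + 2 * theta))) by lra.
      have h2 : 0 < s + (4 * r - (rhom + 2 * theta)) by lra.
      by have := mulr_gt0 h1 h2; rewrite mulNr -signX; lra.
    rewrite theta_S S1 Sm; split; last first.
      move=> lo_neq hi_neq NS NS_pos NS_cvg.
      have [pos neg] := feature _ _ theta_S S1 Sm NS_pos NS_cvg.
      split=> [ev|[/inside /pos//]]; split=> //.
      apply/andP; split; rewrite ltNge; apply/negP => le.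
        by apply: neg ev; apply: below; rewrite lt_neqAle lo_neq.
      by apply: neg ev; apply: above; rewrite lt_neqAle eq_sym hi_neq.
    split=> [Wpos|[/inside pos _] NS NS_pos NS_cvg]; last first.
      by have [+ _] := feature _ _ theta_S S1 Sm NS_pos NS_cvg; apply.
    split=> //; apply/andP; split; rewrite ltNge; apply/negP => le.
      (* At equality with the endpoint the sign is 0, but any shift outwards makes it negative. *)
      apply: (neg_near (-1)) Wpos; first by right.
      by move=> t t0; apply: below; lra.
    apply: (neg_near 1) Wpos; first by left.
    by move=> t t0; apply: above; lra.
  + split.
      (* Shifting away from the vertex makes the square positive even if [rhoS] is the double
         root. *)
      have [X0|X0] := leP 0 X.
        apply: (neg_near 1); first by left.
        move=> t t0; have : 0 < (X + 4 * t) ^+ 2 by rewrite exprn_gt0//; lra.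
        by have := signE (rhoS + 1 * t); rewrite /X; nra.
      apply: (neg_near (-1)); first by right.
      move=> t t0; have : 0 < (4 * t - X) ^+ 2 by rewrite exprn_gt0//; lra.
      by have := signE (rhoS + -1 * t); rewrite /X; nra.
    move=> off NS NS_pos NS_cvg.
    have [_] := feature _ _ theta_S S1 Sm NS_pos NS_cvg; apply.
    suff : DS theta rhoT rhom < X ^+ 2 by have := signE rhoS; rewrite /X; lra.
    case: off => [D_lt0|neq]; first by rewrite (lt_le_trans D_lt0)// sqr_ge0.
    apply: le_lt_trans D0 _; rewrite exprn_even_gt0//=.
    by apply: contraNneq neq => X0; apply/eqP; move: X0; rewrite /X; lra.
- rewrite lt_min => /andP[_ /andP[m1 mS]]; split=> rhom2.
    have neg NS : pos_seq NS -> ratio_cvg NS rhoS ->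
        ~ W2SG_eventually_pos k NT NS m delta.
      move=> NS_pos NS_cvg; have [_] := sample _ _ m1 mS NS_pos NS_cvg; apply.
      rewrite /sample_sign.
      (* The slope is nonpositive and the constant part negative, as [LambdaT > 0], so no borderline
         case occurs. *)
      have h1 : (rhom - 2 * theta) * (rhoS - rhom) <= 0.
        by rewrite mulr_le0_ge0; lra.
      have h2 : 0 < rhom * (LambdaT theta rhoT + rhom - theta).
        by rewrite mulr_gt0//; lra.
      by lra.
    split=> // pos.
    (* Some sequence must have ratio [rhoS], lest [W2SG_pos] hold vacuously. *)
    have [NS NS_pos NS_cvg] := ratio_cvg_exists (ltW rhoS_gt0).
    exact: neg NS_pos NS_cvg (pos _ NS_pos NS_cvg).
  have signE r : sample_sign theta rhoT rhom r =
      (rhom - 2 * theta) * (r - rhoS_threshold theta rhoT rhom).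
    by rewrite /sample_sign /rhoS_threshold; field; lra.
  have above r : rhoS_threshold theta rhoT rhom < r ->
      0 < sample_sign theta rhoT rhom r.
    by move=> lt_r; rewrite signE mulr_gt0// subr_gt0.
  have below r : r < rhoS_threshold theta rhoT rhom ->
      sample_sign theta rhoT rhom r < 0.
    by move=> lt_r; rewrite signE pmulr_rlt0 ?subr_gt0// subr_lt0.
  split; last first.
    move=> neq NS NS_pos NS_cvg.
    have [pos neg] := sample _ _ m1 mS NS_pos NS_cvg.
    split=> [ev|/above/pos//]; rewrite ltNge; apply/negP => le.
    by apply: neg ev; apply: below; rewrite lt_neqAle neq.
  split=> [/W2SG_pos_open[e e0 pos]|lt_S NS NS_pos NS_cvg]; last first.
    by have [+ _] := sample _ _ m1 mS NS_pos NS_cvg; apply; exact: above.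
  rewrite ltNge; apply/negP => le.
  (* A shift to the left of the threshold, small enough to remain above [rhom] and in the ball. *)
  pose t := Num.min e (rhoS - rhom) / 2.
  have [t0 te tm] : [/\ 0 < t, t < e & t < rhoS - rhom].
    have min0 : 0 < t by rewrite divr_gt0// lt_min subr_gt0 e0.
    have le_t : 2 * t <= e /\ 2 * t <= rhoS - rhom.
      by rewrite /t mulrC divfK// !ge_min !lexx !orbT.
    by case: le_t => *; split; lra.
  have mr : rhom < rhoS - t by lra.
  have [NS NS_pos NS_cvg] := ratio_cvg_exists (ltW (lt_trans rhom_gt0 mr)).
  have [_] := sample _ _ m1 mr NS_pos NS_cvg; apply; first by apply: below; lra.
  apply: pos NS_pos NS_cvg.
  by rewrite addrAC subrr add0r normrN gtr0_norm.
Qed.
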